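(* Let $n\ge 2$ be an integer, $a\in\mathbb{R}$, and let $P_n,Q_n\in\mathbb{R}[x,y]$ be homogeneous polynomials of degree $n$. Consider the planar system $$x'=ax-y+P_n(x,y),\qquad y'=x+ay+Q_n(x,y),$$ and define $$\varphi(\theta)=P_n(\cos\theta,\sin\theta)\cos\theta+Q_n(\cos\theta,\sin\theta)\sin\theta,$$ $$\psi(\theta)=Q_n(\cos\theta,\sin\theta)\cos\theta-P_n(\cos\theta,\sin\theta)\sin\theta.$$ Assume that one of the following two sets of conditions holds. (A) $a>0$ and for each $\theta\in[0,2\pi]$: (i) if $\psi(\theta)<0$ then $a\psi(\theta)-\varphi(\theta)\ge 0$; (ii) if $\psi(\theta)>0$ then $\varphi(\theta)\ge 0$; with the inequalities in (i) and (ii) being strict for every $\theta$ in some positive measure set. (B) $a<0$ and for each $\theta\in[0,2\pi]$: (i) if $\psi(\theta)<0$ then $a\psi(\theta)-\varphi(\theta)\le 0$; (ii) if $\psi(\theta)>0$ then $\varphi(\theta)\le 0$; with the inequalities in (i) and (ii) being strict for every $\theta$ in some positive measure set. Then the planar system has at most one limit cycle surrounding the origin.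
   Context: A limit cycle of the planar system is a periodic orbit that is isolated in the set of all periodic orbits. In polar coordinates the system reads $r'=ar+\varphi(\theta)r^n$, $\theta'=1+\psi(\theta)r^{n-1}$. *)

(* Defs.v *)
From HB Require Import structures.
From mathcomp Require Import all_boot all_order all_algebra.
From mathcomp Require Import all_classical all_reals all_analysis.
(* The notations of mpoly clash with those of analysis. *)
From mathcomp Require mpoly.
Import (canonicals, coercions) mpoly.

Set Implicit Arguments.
Unset Strict Implicit.
Unset Printing Implicit Defensive.

Import Order.TTheory GRing.Theory Num.Theory numFieldNormedType.Exports.

Local Open Scope classical_set_scope.
Local Open Scope ring_scope.

Definition bipoly (R : realType) := mpoly.mpoly 2 R.

(* The zero polynomial is homogeneous of every degree. *)
Definition homogeneous (R : realType) (n : nat) (P : bipoly R) : Prop :=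
  P \is mpoly.ishomog1 n (@mpoly.mdeg 2).

Definition eval2 (R : realType) (P : bipoly R) (x y : R) : R :=
  mpoly.meval (tnth [tuple x; y]) P.

Section PlanarSystem.
Variables (R : realType) (a : R) (P Q : bipoly R).

Definition phi (theta : R) : R :=
  eval2 P (cos theta) (sin theta) * cos theta +
  eval2 Q (cos theta) (sin theta) * sin theta.

Definition psi (theta : R) : R :=
  eval2 Q (cos theta) (sin theta) * cos theta -
  eval2 P (cos theta) (sin theta) * sin theta.

Definition is_solution (x y : R -> R) : Prop :=
  forall t : R,
    is_derive t 1 x (a * x t - y t + eval2 P (x t) (y t)) /\
    is_derive t 1 y (x t + a * y t + eval2 Q (x t) (y t)).

(* Orbits are subsets of the plane, so that reparametrizations of the same
   orbit are identified; equilibria are not periodic orbits. *)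
Definition periodic_orbit (G : set (R * R)) : Prop :=
  exists x y : R -> R,
    [/\ is_solution x y,
        exists2 T : R, 0 < T & forall t, x (t + T) = x t /\ y (t + T) = y t,
        exists s t : R, (x s, y s) <> (x t, y t)
      & G = range (fun t => (x t, y t))].

Definition limit_cycle (G : set (R * R)) : Prop :=
  periodic_orbit G /\
  exists U : set (R * R),
    [/\ open U, G `<=` U
      & forall G', periodic_orbit G' -> G' `<=` U -> G' = G].

End PlanarSystem.

(* For a Jordan curve [G], the origin lies in the interior of [G].  The first
   conjunct is needed: [connected_component (~` G) 0] is empty if [G 0]. *)
Definition surrounds_origin (R : realType) (G : set (R * R)) : Prop :=
  ~ G (0, 0) /\ bounded_set (connected_component (~` G) (0, 0)).

(* Main.v *)
Require Import Defs.
From mathcomp Require Import all_boot all_order all_algebra.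
From mathcomp Require Import all_classical all_reals all_analysis.
From mathcomp Require Import ring lra.
From mathcomp Require mpoly.
Import (canonicals, coercions) mpoly.
Import Order.TTheory GRing.Theory Num.Theory numFieldNormedType.Exports.
Local Open Scope classical_set_scope.
Local Open Scope ring_scope.

(** In polar coordinates with [z = r ^- (n - 1)], the system reads
    [z' = - (n - 1) (a z + phi)] and [theta' = (z + psi) / z].  Take [a > 0];
    the case [a < 0] follows by reversing time and the sign of [theta].
    By (i), [w = z + psi] satisfies [w' >= k(t) w] wherever [psi < 0], in
    particular near [w = 0], so [w > 0] is preserved by the flow; and [w <= 0]
    throughout would make [z] nondecreasing, hence constant.  A periodic orbit
    avoiding the origin is therefore traversed with [theta' > 0] and is the
    graph of a periodic function [Z] of [theta] with
    [Z' = - (n - 1) (a Z + phi) Z / (Z + psi)].  The difference [D] of two such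
    functions satisfies [D' = - (n - 1) kappa D] with
    [kappa = a + (phi - a psi) psi / ((Z1 + psi) (Z2 + psi))], and (i), (ii)
    give [kappa > 0].  So [D ^ 2] is periodic and nonincreasing, which forces
    [D = 0]. *)

(** * Derivatives, periodic functions and antiderivatives on the real line *)

Section Calculus.
Context {R : realType}.
Implicit Types (f g F : R -> R) (t : R).

Lemma is_derive1D f g t df dg :
  is_derive t 1 f df -> is_derive t 1 g dg ->
  is_derive t 1 (fun s => f s + g s) (df + dg).
Proof. exact: is_deriveD. Qed.

Lemma is_derive1_cst (c : R) t : is_derive t 1 (fun=> c) (0 : R).
Proof. exact: is_derive_cst. Qed.

Lemma is_derive1N f t df :
  is_derive t 1 f df -> is_derive t 1 (fun s => - f s) (- df).
Proof. exact: is_deriveN. Qed.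

Lemma is_derive1B f g t df dg :
  is_derive t 1 f df -> is_derive t 1 g dg ->
  is_derive t 1 (fun s => f s - g s) (df - dg).
Proof. exact: is_deriveB. Qed.

Lemma is_derive1M f g t df dg :
  is_derive t 1 f df -> is_derive t 1 g dg ->
  is_derive t 1 (fun s => f s * g s) (f t * dg + g t * df).
Proof. exact: is_deriveM. Qed.

Lemma is_derive1X n f t df :
  is_derive t 1 f df ->
  is_derive t 1 (fun s => f s ^+ n) (n%:R * f t ^+ n.-1 * df).
Proof.
move=> fdf; have := is_deriveX n fdf; rewrite (_ : f ^+ n = (fun s => f s ^+ n))//.
by apply/funext => s; elim: n => // n IH; rewrite !exprS -IH.
Qed.

Lemma is_derive1V f t df :
  f t != 0 -> is_derive t 1 f df ->
  is_derive t 1 (fun s => (f s)^-1) (- (f t) ^- 2 * df).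
Proof. exact: is_deriveV. Qed.

Lemma is_derive1_compf g f t df dg :
  is_derive (f t) 1 g dg -> is_derive t 1 f df ->
  is_derive t 1 (fun s => g (f s)) (dg * df).
Proof. exact: is_derive1_comp. Qed.

Lemma is_derive1_continuous f t df :
  is_derive t 1 f df -> {for t, continuous f}.
Proof. by case=> fD _; apply/differentiable_continuous/derivable1_diffP. Qed.

Lemma MVT_line f (df : R -> R) s t : s < t ->
  (forall c : R, is_derive c 1 f (df c)) ->
  exists2 c, s < c < t & f t - f s = df c * (t - s).
Proof.
move=> st fD; have [|c] := @MVT R f df s t st (fun c _ => fD c).
- by apply: derivable_within_continuous => c _; have [] := fD c.
- by rewrite in_itv/=; exists c.
Qed.

Lemma derive_eq0_cst f : (forall t : R, is_derive t 1 f 0) -> forall s t, f s = f t.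
Proof. by move=> fD s t; exact: is_derive_0_is_cst. Qed.

Lemma periodicMn f T : (forall t, f (t + T) = f t) ->
  forall n t, f (t + n%:R * T) = f t.
Proof.
move=> fT; elim=> [|n IH] t; first by rewrite mul0r addr0.
by rewrite -natr1 mulrDl mul1r addrA fT IH.
Qed.

(** Such an [f] is nonincreasing, yet it returns to its starting value after any number of periods,
    so it is constant. *)
Lemma periodic_derive_le0 f (df : R -> R) T : 0 < T -> (forall t, f (t + T) = f t) ->
  (forall t : R, is_derive t 1 f (df t)) -> (forall t, df t <= 0) ->
  forall t, df t = 0.
Proof.
move=> T0 fT fD df0.
have ni s t : s <= t -> f t <= f s.
  rewrite le_eqVlt => /predU1P[->//|st].
  have [c _ e] := MVT_line f df s t st fD.
  by rewrite -subr_le0 e mulr_le0_ge0// subr_ge0 ltW.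
have fcst s t : s <= t -> f t = f s.
  move=> st; apply/eqP; rewrite eq_le ni//=.
  have [n nT] : exists n : nat, t <= s + n%:R * T.
    exists (Num.truncn ((t - s) / T)).+1.
    rewrite -lerBlDl -ler_pdivrMr//; apply: ltW; exact: truncnS_gt.
  by rewrite -(periodicMn f T fT n s); exact: ni.
move=> t; have fc u : f u = cst (f t) u.
  by case: (leP t u) => [/fcst//|/ltW/fcst->].
have -> : df t = 0; last by [].
have /funext fE := fc.
have := fD t; rewrite fE => h; have := @derive_val _ _ _ _ _ _ _ h.
by rewrite derive_cst.
Qed.

(** After the last time in [[s, t]] at which [f] is at least [min c (f s)], [f] stays below [c] and
    hence cannot decrease, so it cannot come down to 0. *)
Lemma stay_pos f (df : R -> R) (c s t : R) : s <= t -> 0 < c ->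
  (forall u : R, is_derive u 1 f (df u)) ->
  (forall u, s <= u <= t -> f u < c -> 0 <= df u) ->
  0 < f s -> 0 < f t.
Proof.
move=> st c0 fD dfc fs0; rewrite ltNge; apply/negP => ft0.
pose d := Num.min c (f s).
have d0 : 0 < d by rewrite lt_min c0 fs0.
have fcont : continuous f by move=> u; exact: is_derive1_continuous (fD u).
pose S : set R := [set` `[s, t]%R] `&` [set u | d <= f u].
have S0 : S !=set0.
  by exists s; split; rewrite /= ?in_itv/= ?lexx ?st// /d ge_min lexx orbT.
have Sc : compact S.
  apply: compact_closedI; first exact: segment_compact.
  have : closed (f @^-1` [set y | d <= y]).
    by apply: preimage_closed => [u _|]; [exact: fcont|exact: closed_ge].
  by [].
have idc : {within S, continuous (@id R)}.
  by apply: continuous_subspaceT => u; exact: cvg_id.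
have [m mS mmax] := @compact_EVT_max R R id S S0 Sc idc.
move: mS; rewrite inE => -[]; rewrite /= in_itv/= => /andP[sm mt] dfm.
have {}mt : m < t.
  rewrite lt_neqAle mt andbT; apply/eqP => mt'; move: dfm.
  by rewrite mt' => /(lt_le_trans d0); rewrite ltNge ft0.
have [u /andP[mu ut] e] := MVT_line f df m t mt fD.
have fud : f u < d.
  rewrite ltNge; apply/negP => dfu; have : u <= m.
    apply: mmax; rewrite inE; split => //=.
    by rewrite in_itv/= (ltW ut) (le_trans sm (ltW mu)).
  by rewrite leNgt mu.
have : 0 <= df u.
  apply: dfc; first by rewrite (ltW ut) (le_trans sm (ltW mu)).
  by apply: lt_le_trans fud _; rewrite /d ge_min lexx.
move=> dfu; have : 0 <= f t - f m by rewrite e mulr_ge0// subr_ge0 ltW.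
by lra.
Qed.

Lemma antiderivative f : continuous f ->
  exists F, forall t : R, is_derive t 1 F (f t).
Proof.
move=> cf.
pose mu := @lebesgue_measure R.
have itg a b : mu.-integrable `[a, b] (EFin \o f).
  apply: continuous_compact_integrable; first exact: segment_compact.
  exact: continuous_subspaceT.
(* The second integral normalizes [G a] to vanish at 0, so [G a x] does not depend on [a] as long as
   [a] lies below both [x] and 0. *)
pose G a x := \int[mu]_(s in `[a, x]) f s - \int[mu]_(s in `[a, 0]) f s.
have Gab a b (x : R) : b <= a -> a <= x -> a <= 0 -> G b x = G a x.
  move=> ba ax a0; rewrite /G.
  have e y : a <= y -> \int[mu]_(s in `[b, y]) f s
       = \int[mu]_(s in `[b, a]) f s + \int[mu]_(s in `[a, y]) f s.
    move=> ay; apply/eqP; rewrite addrC -subr_eq; apply/eqP.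
    rewrite Rintegral_itvB ?bnd_simp//.
    rewrite Rintegral_itv_obnd_cbnd//.
    by apply: integrableS (itg a y) => //; apply: subset_itvr; rewrite bnd_simp.
  by rewrite (e x ax) (e 0 a0) opprD addrACA subrr add0r.
(* Moving the base point with [x] extends the one-sided FTC to the whole line. *)
exists (fun x => G (- `|x| - 1) x) => t.
(* This base point lies below -|x| - 1 for every [x] within distance 1 of [t]. *)
pose a : R := - `|t| - 2.
have leNnorm (u : R) : - `|u| <= u by rewrite lerNl -normrN ler_norm.
have Ga : is_derive t 1 (G a) (f t).
  rewrite -[f t]subr0; apply: (is_derive1B (fun x => \int[mu]_(s in `[a, x]) f s)
    (fun=> \int[mu]_(s in `[a, 0]) f s)).
  have [|||D1 D2] := @continuous_FTC1_closed R f a t (t + 1) _ (itg a (t + 1)).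
  - by rewrite ltrDl.
  - by rewrite /a; have := leNnorm t; lra.
  - exact: cf.
  by apply: DeriveDef; [exact: D1|rewrite -derive1E; exact: D2].
apply: near_eq_is_derive Ga.
near=> x.
have xt : `|x - t| < 1 by rewrite distrC; near: x; exact: nbhsx_ballx.
apply: (Gab (- `|x| - 1) a).
- rewrite /a; have := ler_normD t (x - t); rewrite (_ : t + (x - t) = x); [lra|ring].
- by have := leNnorm x; lra.
- by have := normr_ge0 x; lra.
Unshelve. all: by end_near. Qed.



(** * Uniqueness of periodic orbits for the polar equations *)

Lemma is_derive1_eq f t (df df' : R) :
  is_derive t 1 f df -> df = df' -> is_derive t 1 f df'.
Proof. by move=> fD <-. Qed.

(** With [w = z + psi], positivity of [w] is first found at some time; an integrating factor
    propagates it forward, and periodicity carries it to every time. *)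
Lemma angular_speed_gt0 (N a T : R) (phi psi dpsi z th : R -> R) :
  0 < N -> 0 < a -> 0 < T ->
  (forall u : R, is_derive u 1 psi (dpsi u)) -> continuous dpsi ->
  (forall u, psi u < 0 -> 0 <= a * psi u - phi u) ->
  (forall t, 0 < z t) ->
  (forall t : R, is_derive t 1 z (- N * (a * z t + phi (th t)))) ->
  (forall t : R, is_derive t 1 th ((z t + psi (th t)) / z t)) ->
  (forall t, z (t + T) = z t) ->
  (forall t, psi (th (t + T)) = psi (th t)) ->
  (exists s t, (z s, th s) <> (z t, th t)) ->
  forall t, 0 < z t + psi (th t).
Proof.
move=> N0 a0 T0 psiD cdpsi hneg z0 zD thD zT psiT [s0 [t0 nst]].
pose w t := z t + psi (th t).
have wT t : w (t + T) = w t by rewrite /w zT psiT.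
have psi_lt0 t : w t < z t -> psi (th t) < 0 by rewrite /w; lra.
have [t1 wt1] : exists t, 0 < w t.
  (* If [w <= 0] throughout, then [psi < 0] and [hneg] bounds [a z + phi] by [a w <= 0]. The
     periodic [z] is then monotone, hence constant, and [w = 0] stops the angle as well,
     contradicting [nst]. *)
  apply: contrapT => nw.
  have w_le0 t : w t <= 0 by rewrite leNgt; apply/negP => ?; apply: nw; exists t.
  have psin t : psi (th t) < 0.
    by apply: psi_lt0; apply: le_lt_trans (w_le0 t) (z0 t).
  have aw t : a * z t + phi (th t) <= a * w t.
    by have := hneg _ (psin t); rewrite /w; lra.
  have dz0 : forall t, N * (a * z t + phi (th t)) = 0.
    apply: (@periodic_derive_le0 (fun t => - z t) _ T) => //.
    - by move=> t; rewrite zT.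
    - by move=> t; apply: (is_derive1_eq _ _ _ _ (is_derive1N _ _ _ (zD t))); ring.
    - move=> t; rewrite pmulr_rle0//; apply: le_trans (aw t) _.
      by rewrite pmulr_rle0.
  have w0 t : w t = 0.
    have : a * z t + phi (th t) = 0.
      by have /eqP := dz0 t; rewrite mulf_eq0 gt_eqF//= => /eqP.
    have := aw t => + e; rewrite e pmulr_rge0// => w_ge0.
    by apply/eqP; rewrite eq_le w_le0 w_ge0.
  apply: nst; congr (_, _); apply: derive_eq0_cst => t.
    by apply: (is_derive1_eq _ _ _ _ (zD t)); rewrite mulNr dz0 oppr0.
  by apply: (is_derive1_eq _ _ _ _ (thD t)); rewrite -/(w t) w0 mul0r.
(* Chosen so that [w' = k w + N (a psi - phi)]: [E = exp (- K)] is an integrating factor, and [w E]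
   has nonnegative derivative wherever [psi < 0]. *)
pose k t := dpsi (th t) / z t - N * a.
have zc : continuous z by move=> t; exact: is_derive1_continuous (zD t).
have thc : continuous th by move=> t; exact: is_derive1_continuous (thD t).
have kc : continuous k.
  move=> t; apply: (@continuousB _ _ _ (fun t => dpsi (th t) / z t) (cst (N * a))).
    apply: (@continuousM _ _ (fun t => dpsi (th t)) (fun t => (z t)^-1)).
      by apply: (@continuous_comp _ _ _ th dpsi); [exact: thc|exact: cdpsi].
    by apply: continuousV; [rewrite gt_eqF|exact: zc].
  exact: cst_continuous.
have [K KD] := antiderivative k kc.
pose E t := expR (- K t).
have ED t : is_derive t 1 E (- k t * E t).
  have := is_derive1_compf expR _ t _ _ (is_derive_expR _) (is_derive1N _ _ _ (KD t)).
  by move/is_derive1_eq; apply; rewrite mulrC.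
have E0 t : 0 < E t by exact: expR_gt0.
have mD t : is_derive t 1 (fun t => w t * E t)
    (N * (a * psi (th t) - phi (th t)) * E t).
  have pD := is_derive1_compf psi th t _ _ (psiD _) (thD t).
  have := is_derive1M _ _ _ _ _ (is_derive1D _ _ _ _ _ (zD t) pD) (ED t).
  move/is_derive1_eq; apply.
  rewrite /w /k; by field; rewrite gt_eqF.
move=> t.
have [n tn] : exists n : nat, t1 <= t + n%:R * T.
  exists (Num.truncn ((t1 - t) / T)).+1.
  by rewrite -lerBlDl -ler_pdivrMr//; apply: ltW; exact: truncnS_gt.
rewrite -[X in 0 < X]/(w t) -(periodicMn w T wT n t).
set t2 := t + _ in tn *.
have zEc : continuous (fun t => z t * E t).
  move=> u; apply: (@continuousM _ _ z E); first exact: zc.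
  exact: is_derive1_continuous (ED u).
(* The minimum of [z E] serves as the threshold of [stay_pos]: where [w E] is below it, [w < z],
   which means [psi < 0]. *)
have [c _ cmin] := EVT_min tn (continuous_subspaceT zEc).
suff : 0 < w t2 * E t2 by rewrite pmulr_lgt0.
apply: (stay_pos (fun t => w t * E t) _ (z c * E c) t1 t2 tn _ mD).
- exact: mulr_gt0.
- move=> u tut wE; apply: mulr_ge0; last exact: ltW.
  apply: mulr_ge0; first exact: ltW.
  apply: hneg; apply: psi_lt0; rewrite -(ltr_pM2r (E0 u)).
  by apply: lt_le_trans wE (cmin _ _); rewrite in_itv.
- exact: mulr_gt0.
Qed.

Lemma periodicMz (f : R -> R) T : (forall t, f (t + T) = f t) ->
  forall (k : int) t, f (t + k%:~R * T) = f t.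
Proof.
move=> fT [n|n] t; first by rewrite -pmulrn; exact: periodicMn.
by rewrite NegzE mulrNz mulNr -(periodicMn f T fT n.+1) pmulrn subrK.
Qed.

(** Positive angular speed makes [th] an increasing bijection of the line, so the angle can replace
    time; dividing [z'] by [th'] gives the new equation. *)
Lemma angle_reparametrization (N a T L : R) (phi psi z th : R -> R) :
  0 < T ->
  (forall t, 0 < z t) -> (forall t, 0 < z t + psi (th t)) ->
  (forall t : R, is_derive t 1 z (- N * (a * z t + phi (th t)))) ->
  (forall t : R, is_derive t 1 th ((z t + psi (th t)) / z t)) ->
  (forall t, z (t + T) = z t) -> (forall t, th (t + T) = th t + L) ->
  0 < L /\ exists tau : R -> R,
    [/\ cancel tau th, cancel th tau,
        forall u : R, is_derive u 1 (fun v => z (tau v))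
          (- N * ((a * z (tau u) + phi u) * z (tau u) / (z (tau u) + psi u)))
      & forall u, z (tau (u + L)) = z (tau u)].
Proof.
move=> T0 z0 w0 zD thD zT thL.
have th_lt s t : s < t -> th s < th t.
  move=> st; have [c _ e] := MVT_line th _ s t st thD.
  by rewrite -subr_gt0 e mulr_gt0// ?subr_gt0// divr_gt0.
have L0 : 0 < L.
  by have := th_lt 0 T T0; rewrite -[in th T](add0r T) thL ltrDl.
split=> //.
have th_inj s t : th s = th t -> s = t.
  by case: (ltgtP s t) => // /th_lt + e; rewrite e ltxx.
have thc : continuous th by move=> t; exact: is_derive1_continuous (thD t).
have thLn n t : th (t + n%:R * T) = th t + n%:R * L.
  elim: n => [|n IH]; first by rewrite !mul0r !addr0.
  by rewrite -natr1 !mulrDl !mul1r addrA thL IH addrA.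
have /choice[tau tauK] : forall u, exists t, th t = u.
  (* Since [th] gains [L] per period, its values [n] periods before and after time 0 bracket [u]. *)
  move=> u; pose n := (Num.truncn (`|u - th 0| / L)).+1.
  have hn : `|u - th 0| <= n%:R * L.
    by rewrite -ler_pdivrMr//; apply: ltW; exact: truncnS_gt.
  have nT0 : 0 <= n%:R * T by rewrite mulr_ge0// ltW.
  have e1 := thLn n 0; rewrite add0r in e1.
  have e2 : th (- (n%:R * T)) = th 0 - n%:R * L.
    by have := thLn n (- (n%:R * T)); rewrite addNr => ->; rewrite addrK.
  have [|||c _ cu] := @IVT R th (- (n%:R * T)) (n%:R * T) u.
  - by lra.
  - exact: continuous_subspaceT.
  - move: hn; rewrite ler_norml e1 e2 => /andP[h1 h2].
    rewrite ge_min le_max; apply/andP; split; apply/orP; [left|right]; lra.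
  - by exists c.
exists tau; split=> //.
- by move=> t; apply: th_inj; rewrite tauK.
- move=> u.
  have tauD : is_derive u 1 tau ((z (tau u) + psi u) / z (tau u))^-1.
    have thK : \forall t \near tau u, tau (th t) = t.
      by near=> t; apply: th_inj; rewrite tauK.
    have cth : \forall t \near tau u, {for t, continuous th}.
      by near=> t; exact: thc.
    have := @is_derive_inverse R th tau _ (tau u) thK cth (thD (tau u)).
    by rewrite tauK; apply; rewrite gt_eqF// divr_gt0// -{2}(tauK u).
  have := is_derive1_compf z tau u _ _ (zD _) tauD.
  move/is_derive1_eq; apply; rewrite tauK.
  have := w0 (tau u); rewrite tauK => w0u.
  by field; rewrite !gt_eqF.
(* By injectivity of [th], [tau (u + L) = tau u + T]. *)
- by move=> u; rewrite -[RHS]zT; congr z; apply: th_inj; rewrite thL !tauK.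
Unshelve. all: by end_near. Qed.

Lemma contracting_unique (N a L : R) (phi psi Z1 Z2 : R -> R) :
  0 < N -> 0 < a -> 0 < L ->
  (forall u, psi u < 0 -> 0 <= a * psi u - phi u) ->
  (forall u, 0 < psi u -> 0 <= phi u) ->
  (forall u, 0 < Z1 u) -> (forall u, 0 < Z2 u) ->
  (forall u, 0 < Z1 u + psi u) -> (forall u, 0 < Z2 u + psi u) ->
  (forall u : R, is_derive u 1 Z1
     (- N * ((a * Z1 u + phi u) * Z1 u / (Z1 u + psi u)))) ->
  (forall u : R, is_derive u 1 Z2
     (- N * ((a * Z2 u + phi u) * Z2 u / (Z2 u + psi u)))) ->
  (forall u, Z1 (u + L) = Z1 u) -> (forall u, Z2 (u + L) = Z2 u) ->
  Z1 =1 Z2.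
Proof.
move=> N0 a0 L0 hneg hpos Z10 Z20 w10 w20 Z1D Z2D Z1L Z2L u.
pose kap v := (a * Z1 v * Z2 v + a * psi v * (Z1 v + Z2 v) + phi v * psi v)
  / ((Z1 v + psi v) * (Z2 v + psi v)).
have kap0 v : 0 < kap v.
  rewrite divr_gt0 ?mulr_gt0//.
  (* For [psi < 0] the numerator is read as [a (Z1 + psi) (Z2 + psi) - psi (a psi - phi)], a
     positive plus a nonnegative term. Otherwise its expanded form is a sum of nonnegative terms,
     the first of them positive. *)
  case: (ltP (psi v) 0) => [ps0|ps0].
    have h1 : 0 < a * ((Z1 v + psi v) * (Z2 v + psi v)) by rewrite !mulr_gt0.
    have h2 : 0 <= - psi v * (a * psi v - phi v).
      by rewrite mulr_ge0 ?hneg// oppr_ge0 ltW.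
    lra.
  have h1 : 0 < a * Z1 v * Z2 v by rewrite !mulr_gt0.
  have h2 : 0 <= a * psi v * (Z1 v + Z2 v).
    by rewrite mulr_ge0// ?mulr_ge0// ?addr_ge0// ltW.
  have h3 : 0 <= phi v * psi v.
    move: ps0; rewrite le_eqVlt => /predU1P[<-|ps0]; first by rewrite mulr0.
    by rewrite mulr_ge0 ?hpos// ltW.
  lra.
have VD (v : R) : is_derive v 1 (fun v => (Z1 v - Z2 v) * (Z1 v - Z2 v))
    (- (2 * N) * (kap v * ((Z1 v - Z2 v) * (Z1 v - Z2 v)))).
  have h := is_derive1B _ _ _ _ _ (Z1D v) (Z2D v).
  have := is_derive1M _ _ _ _ _ h h.
  move/is_derive1_eq; apply; rewrite /kap.
  by field; rewrite !gt_eqF.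
have : - (2 * N) * (kap u * ((Z1 u - Z2 u) * (Z1 u - Z2 u))) = 0.
  apply: (periodic_derive_le0 _ _ L L0 _ VD) => v; first by rewrite Z1L Z2L.
  rewrite mulNr oppr_le0; apply: mulr_ge0; first by rewrite mulr_ge0// ltW.
  by apply: mulr_ge0; [exact: ltW|rewrite -expr2 sqr_ge0].
have N20 : 2 * N != 0 by rewrite gt_eqF// mulr_gt0.
move/eqP; rewrite mulf_eq0 oppr_eq0 (negPf N20)/= mulf_eq0 gt_eqF//=.
by rewrite -expr2 sqrf_eq0 subr_eq0 => /eqP.
Qed.

(* [z] stands for [r ^- (n - 1)], which turns the radial equation
   into an affine one; [N = n - 1]. *)
Definition polar_orbit (N a : R) (phi psi z th : R -> R) : Prop :=
  [/\ forall t, 0 < z t,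
      forall t : R, is_derive t 1 z (- N * (a * z t + phi (th t))),
      forall t : R, is_derive t 1 th ((z t + psi (th t)) / z t),
      exists (T : R) (k : int), 0 < T /\
        forall t, z (t + T) = z t /\ th (t + T) = th t + k%:~R * (pi *+ 2)
    & exists s t, (z s, th s) <> (z t, th t)].

(** The angle serves as time: [Z u] is [z (tau u)] with [tau] inverse to [th]. Over one time period
    the angle gains [k] full turns, and [k] is positive because [th] increases. *)
Lemma polar_orbit_graph (N a : R) (phi psi dpsi z th : R -> R) :
  0 < N -> 0 < a ->
  (forall u : R, is_derive u 1 psi (dpsi u)) -> continuous dpsi ->
  (forall u, psi (u + pi *+ 2) = psi u) ->
  (forall u, psi u < 0 -> 0 <= a * psi u - phi u) ->
  polar_orbit N a phi psi z th ->
  exists (Z : R -> R) (k : nat),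
    [/\ forall t, z t = Z (th t), forall u, exists t, th t = u, (0 < k)%N &
    [/\ forall u, 0 < Z u, forall u, 0 < Z u + psi u,
        forall u : R, is_derive u 1 Z
          (- N * ((a * Z u + phi u) * Z u / (Z u + psi u)))
      & forall u, Z (u + k%:R * (pi *+ 2)) = Z u]].
Proof.
move=> N0 a0 psiD cdpsi psip hneg [z0 zD thD [T [k [T0 kT]]] nst].
have zT t : z (t + T) = z t by have [] := kT t.
have thT t : th (t + T) = th t + k%:~R * (pi *+ 2) by have [] := kT t.
have w0 : forall t, 0 < z t + psi (th t).
  apply: (angular_speed_gt0 _ _ _ _ _ _ _ _ N0 a0 T0 psiD cdpsi hneg z0 zD thD zT) => //.
  by move=> t; rewrite thT periodicMz.
have [kp0 [tau [tauK thK ZD Zp]]] :=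
  angle_reparametrization _ _ _ _ _ _ _ _ T0 z0 w0 zD thD zT thT.
have k0 : 0 < k.
  have pi2 : 0 < (pi : R) *+ 2 by rewrite pmulrn_lgt0// pi_gt0.
  by move: kp0; rewrite pmulr_lgt0// ltr0z.
case: k k0 kp0 thT kT Zp => // k k0 _ _ _ Zp.
exists (fun u => z (tau u)), k; split=> //.
- by move=> t; rewrite thK.
- by move=> u; exists (tau u).
- by split=> // u; have := w0 (tau u); rewrite tauK.
Qed.

Lemma polar_orbit_unique_pos (N a : R) (phi psi dpsi z1 th1 z2 th2 : R -> R) :
  0 < N -> 0 < a ->
  (forall u : R, is_derive u 1 psi (dpsi u)) -> continuous dpsi ->
  (forall u, psi (u + pi *+ 2) = psi u) ->
  (forall u, psi u < 0 -> 0 <= a * psi u - phi u) ->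
  (forall u, 0 < psi u -> 0 <= phi u) ->
  polar_orbit N a phi psi z1 th1 -> polar_orbit N a phi psi z2 th2 ->
  forall t, exists s, z1 t = z2 s /\ th1 t = th2 s.
Proof.
move=> N0 a0 psiD cdpsi psip hneg hpos o1 o2 t.
have [Z1 [k1 [Z1E _ k10 [Z10 w10 Z1D Z1p]]]] :=
  polar_orbit_graph _ _ _ _ _ _ _ N0 a0 psiD cdpsi psip hneg o1.
have [Z2 [k2 [Z2E th2s k20 [Z20 w20 Z2D Z2p]]]] :=
  polar_orbit_graph _ _ _ _ _ _ _ N0 a0 psiD cdpsi psip hneg o2.
have Z12 : Z1 =1 Z2.
  (* The two orbits might close after different numbers of turns, so a common multiple of both
     angular periods is used. *)
  apply: (contracting_unique N a (k2%:R * (k1%:R * (pi *+ 2))) phi psi) => //.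
  - by rewrite !mulr_gt0 ?ltr0n// pmulrn_lgt0// pi_gt0.
  - exact: periodicMn.
  - by move=> u; rewrite mulrCA; exact: periodicMn.
have [s sE] := th2s (th1 t).
by exists s; rewrite Z1E Z2E Z12 sE.
Qed.

(** Time reversal flips the sign of the angular speed; reflecting the angle restores it. Hence [psi]
    keeps its sign while [a] and [phi] change theirs. *)
Lemma polar_orbitN (N a : R) (phi psi z th : R -> R) :
  polar_orbit N a phi psi z th ->
  polar_orbit N (- a) (fun u => - phi (- u)) (fun u => psi (- u))
    (fun t => z (- t)) (fun t => - th (- t)).
Proof.
move=> [z0 zD thD [T [k [T0 kT]]] [s [t st]]].
have ND (t' : R) := is_derive1N _ _ _ (is_derive_id t' (1 : R)).
split=> //.
- move=> u; have := is_derive1_compf z _ u _ _ (zD _) (ND u).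
  by move/is_derive1_eq; apply; rewrite opprK; ring.
- move=> u.
  have := is_derive1N _ _ _ (is_derive1_compf th _ u _ _ (thD _) (ND u)).
  by move/is_derive1_eq; apply; rewrite opprK; ring.
- exists T, k; split=> // u; have [e1 e2] := kT (- (u + T)).
  have e : - (u + T) + T = - u by ring.
  by rewrite -e1 e; split=> //; rewrite -[in RHS]e e2; ring.
- exists (- s), (- t); rewrite !opprK => -[e1 /oppr_inj e2].
  by apply: st; rewrite e1 e2.
Qed.

Lemma polar_orbit_unique (N a : R) (phi psi dpsi z1 th1 z2 th2 : R -> R) :
  0 < N ->
  (forall u : R, is_derive u 1 psi (dpsi u)) -> continuous dpsi ->
  (forall u, psi (u + pi *+ 2) = psi u) ->
  [/\ 0 < a, forall u, psi u < 0 -> 0 <= a * psi u - phi u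
    & forall u, 0 < psi u -> 0 <= phi u] \/
  [/\ a < 0, forall u, psi u < 0 -> a * psi u - phi u <= 0
    & forall u, 0 < psi u -> phi u <= 0] ->
  polar_orbit N a phi psi z1 th1 -> polar_orbit N a phi psi z2 th2 ->
  forall t, exists s, z1 t = z2 s /\ th1 t = th2 s.
Proof.
move=> N0 psiD cdpsi psip [[a0 hneg hpos]|[a0 hneg hpos]] o1 o2 t.
  exact: (polar_orbit_unique_pos _ _ _ _ _ _ _ _ _ N0 a0 psiD cdpsi psip hneg hpos o1 o2).
(* The reversal turns the second set of conditions into the first one, for [- a], [- phi (- u)] and
   [psi (- u)]. *)
have Na0 : 0 < - a by rewrite oppr_gt0.
have ND (t' : R) := is_derive1N _ _ _ (is_derive_id t' (1 : R)).
have NpsiD (u : R) : is_derive u 1 (fun u => psi (- u)) (- dpsi (- u)).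
  have := is_derive1_compf psi _ u _ _ (psiD _) (ND u).
  by move/is_derive1_eq; apply; rewrite mulrN1.
have Ncdpsi : continuous (fun u => - dpsi (- u)).
  move=> u; apply: (@continuousN _ _ _ (fun u => dpsi (- u))).
  apply: (@continuous_comp _ _ _ -%R dpsi); last exact: cdpsi.
  exact: is_derive1_continuous (ND u).
have Npsip u : psi (- (u + pi *+ 2)) = psi (- u).
  by rewrite -(psip (- (u + _))); congr psi; ring.
have Nhneg u : psi (- u) < 0 -> 0 <= - a * psi (- u) - - phi (- u).
  by move=> /hneg; lra.
have Nhpos u : 0 < psi (- u) -> 0 <= - phi (- u) by move=> /hpos; lra.
have [s [e1 e2]] := polar_orbit_unique_pos _ _ _ _ _ _ _ _ _ N0 Na0 NpsiD Ncdpsi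
  Npsip Nhneg Nhpos (polar_orbitN _ _ _ _ _ _ o1) (polar_orbitN _ _ _ _ _ _ o2) (- t).
by exists (- s); move: e1 e2; rewrite !opprK => -> /oppr_inj ->.
Qed.

End Calculus.

(** * Homogeneity and regularity of the polynomial field *)

Section Planar.
Context {R : realType}.
Implicit Types (P Q : bipoly R) (x y : R -> R).

Lemma eval2E P (x y : R) : eval2 P x y =
  \sum_(m <- mpoly.msupp P) mpoly.mcoeff m P * (x ^+ m ord0 * y ^+ m (lift ord0 ord0)).
Proof.
rewrite /eval2 mpoly.mevalE; apply: eq_bigr => m _; congr (_ * _).
by rewrite !big_ord_recl big_ord0 mulr1 /tnth/=; congr (_ * _ ^+ m _); apply: val_inj.
Qed.

Lemma eval2_homog n P (r x y : R) : homogeneous n P ->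
  eval2 P (r * x) (r * y) = r ^+ n * eval2 P x y.
Proof.
move=> /mpoly.dhomogP hP; rewrite !eval2E mulr_sumr; apply: eq_big_seq => m mP.
have <- : (m ord0 + m (lift ord0 ord0))%N = n.
  transitivity (mpoly.mdeg m); last exact: hP.
  rewrite mpoly.mdegE !big_ord_recl big_ord0 addn0.
  by congr (m _ + m _)%N; apply: val_inj.
by rewrite !exprMn exprD; ring.
Qed.

(** Evaluating a polynomial uses only constants, sums and products; this serves both for continuity
    and for [C1]. *)
Lemma eval2_closed (C : (R -> R) -> Prop) P x y :
  (forall c : R, C (fun=> c)) ->
  (forall f g, C f -> C g -> C (fun t => f t + g t)) ->
  (forall f g, C f -> C g -> C (fun t => f t * g t)) ->
  C x -> C y -> C (fun t => eval2 P (x t) (y t)).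
Proof.
move=> Cc CD CM Cx Cy.
have CX f k : C f -> C (fun t => f t ^+ k).
  move=> Cf; elim: k => [|k IH]; first exact: Cc.
  by under eq_fun do rewrite exprS; exact: CM.
under eq_fun do rewrite eval2E.
elim: (mpoly.msupp P) => [|m s IH].
  by under eq_fun do rewrite big_nil; exact: Cc.
under eq_fun do rewrite big_cons.
by apply: CD => //; apply: (CM); [exact: Cc|apply: CM; exact: CX].
Qed.

Lemma continuous_cstf (c : R) : continuous (fun _ : R => c).
Proof. exact: cst_continuous. Qed.

Lemma continuous_addf (f g : R -> R) : continuous f -> continuous g ->
  continuous (fun t => f t + g t).
Proof. by move=> cf cg t; exact: continuousD (cf t) (cg t). Qed.

Lemma continuous_mulf (f g : R -> R) : continuous f -> continuous g ->
  continuous (fun t => f t * g t).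
Proof. by move=> cf cg t; exact: continuousM (cf t) (cg t). Qed.

Lemma continuous_oppf (f : R -> R) : continuous f -> continuous (fun t => - f t).
Proof. by move=> cf t; exact: continuousN (cf t). Qed.

Definition C1 (f : R -> R) : Prop :=
  exists2 df : R -> R, continuous df & forall t : R, is_derive t 1 f (df t).

Lemma C1_continuous f : C1 f -> continuous f.
Proof. by case=> df _ fD t; exact: is_derive1_continuous (fD t). Qed.

Lemma C1_cst (c : R) : C1 (fun _ : R => c).
Proof.
by exists (fun=> 0); [exact: continuous_cstf|move=> t; exact: is_derive1_cst].
Qed.

Lemma C1_add f g : C1 f -> C1 g -> C1 (fun t => f t + g t).
Proof.
move=> [df cdf fD] [dg cdg gD]; exists (fun t => df t + dg t).
  exact: continuous_addf.
by move=> t; exact: is_derive1D.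
Qed.

Lemma C1_mul f g : C1 f -> C1 g -> C1 (fun t => f t * g t).
Proof.
move=> Cf Cg; have [df cdf fD] := Cf; have [dg cdg gD] := Cg.
exists (fun t => f t * dg t + g t * df t); last by move=> t; exact: is_derive1M.
by apply: continuous_addf; apply: continuous_mulf => //; exact: C1_continuous.
Qed.

Lemma C1_cos : C1 (@cos R).
Proof.
exists (fun t => - sin t); first exact: continuous_oppf (@continuous_sin R).
by move=> t; exact: is_derive_cos.
Qed.

Lemma C1_sin : C1 (@sin R).
Proof.
by exists (@cos R); [exact: continuous_cos|move=> t; exact: is_derive_sin].
Qed.

Lemma C1_psi P Q : C1 (psi P Q).
Proof.
have CE P' : C1 (fun t => eval2 P' (cos t) (sin t)).
  by apply: eval2_closed; [exact: C1_cst|exact: C1_add|exact: C1_mul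
    |exact: C1_cos|exact: C1_sin].
have -> : psi P Q = fun t => eval2 Q (cos t) (sin t) * cos t +
    (-1) * (eval2 P (cos t) (sin t) * sin t).
  by apply/funext => t; rewrite /psi mulN1r.
apply: C1_add; first exact: C1_mul (CE _) C1_cos.
by apply: C1_mul; [exact: C1_cst|exact: C1_mul (CE _) C1_sin].
Qed.

Lemma phiD2pi P Q u : phi P Q (u + pi *+ 2) = phi P Q u.
Proof. by rewrite /phi cosD2pi sinD2pi. Qed.

Lemma psiD2pi P Q u : psi P Q (u + pi *+ 2) = psi P Q u.
Proof. by rewrite /psi cosD2pi sinD2pi. Qed.

(** * Polar angles and the lift of a solution to polar coordinates *)

Lemma angle_modulo (u : R) :
  exists (k : int) (v : R), 0 <= v < pi *+ 2 /\ u = v + k%:~R * (pi *+ 2).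
Proof.
have p0 : 0 < (pi : R) *+ 2 by rewrite pmulrn_lgt0// pi_gt0.
exists (Num.floor (u / (pi *+ 2))), (u - (Num.floor (u / (pi *+ 2)))%:~R * (pi *+ 2)).
split; last by rewrite subrK.
rewrite subr_ge0 ltrBlDr -ler_pdivlMr// floor_le/= -[X in X + _]mul1r -mulrDl.
by rewrite -ltr_pdivrMr// addrC -intrD1 floorD1_gt.
Qed.

Lemma cos_eq1 (u : R) : cos u = 1 -> exists k : int, u = k%:~R * (pi *+ 2).
Proof.
have [k [v [/andP[v0 vp] ->]]] := angle_modulo u.
rewrite periodicMz; last exact: cosD2pi.
move=> cv; exists k; suff -> : v = 0 by rewrite add0r.
have pi0 := pi_gt0 R.
case: (leP v pi) => vpi.
  apply: cos_inj; last by rewrite cos0.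
    by rewrite in_itv/= v0.
  by rewrite in_itv/= lexx ltW.
(* For [v > pi] the reflected angle [2 pi - v] lies in [[0, pi]], where cosine is injective; it
   would vanish, contrary to [v < 2 pi]. *)
suff : pi *+ 2 - v = 0 by lra.
apply: cos_inj.
- by rewrite in_itv/=; apply/andP; split; lra.
- by rewrite in_itv/= lexx ltW.
- by rewrite addrC cosD2pi cosN cv cos0.
Qed.

Lemma polar_coordinates (x y : R) : (x, y) <> (0, 0) ->
  exists r t : R, [/\ 0 < r, x = r * cos t & y = r * sin t].
Proof.
move=> xy0; pose q := x ^+ 2 + y ^+ 2.
have q0 : 0 < q.
  rewrite lt_neqAle addr_ge0 ?sqr_ge0// andbT eq_sym.
  rewrite paddr_eq0 ?sqr_ge0// !sqrf_eq0; apply/negP => /andP[/eqP x0 /eqP y0].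
  by apply: xy0; rewrite x0 y0.
pose r := Num.sqrt q.
have r0 : 0 < r by rewrite sqrtr_gt0.
have r2 : r ^+ 2 = q by rewrite sqr_sqrtr// ltW.
have xr : -1 <= x / r <= 1.
  rewrite -ler_norml normrM normfV (gtr0_norm r0) ler_pdivrMr// mul1r.
  by rewrite -sqrtr_sqr ler_wsqrtr// lerDl sqr_ge0.
have sxr : Num.sqrt (1 - (x / r) ^+ 2) = `|y| / r.
  have -> : 1 - (x / r) ^+ 2 = (y / r) ^+ 2.
    have : r ^+ 2 = x ^+ 2 + y ^+ 2 by [].
    have rn0 : r != 0 by rewrite gt_eqF.
    by move=> e; rewrite !expr_div_n e; field; rewrite -e sqrf_eq0.
  by rewrite sqrtr_sqr normrM normfV (gtr0_norm r0).
have rK u : r * (u / r) = u by rewrite mulrC divfK// gt_eqF.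
(* [acos] yields only angles of nonnegative sine; for [y < 0] the opposite angle is taken. *)
case: (leP 0 y) => y0.
  exists r, (acos (x / r)); split=> //; first by rewrite acosK// rK.
  by rewrite sin_acos// sxr ger0_norm// rK.
exists r, (- acos (x / r)); split=> //; first by rewrite cosN acosK// rK.
by rewrite sinN sin_acos// sxr ltr0_norm// mulNr opprK rK.
Qed.

(** A continuous angle along the solution comes from integrating the angular speed, starting from a
    polar angle at time 0. In the frame rotated by it the solution stays on the positive first axis,
    so its first coordinate [C] is the radius. *)
Lemma polar_lift (m : nat) (a : R) P Q x y (T : R) : (0 < m)%N ->
  homogeneous m.+1 P -> homogeneous m.+1 Q ->
  is_solution a P Q x y -> (forall t, (x t, y t) <> (0, 0)) ->
  0 < T -> (forall t, x (t + T) = x t /\ y (t + T) = y t) ->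
  (exists s t, (x s, y s) <> (x t, y t)) ->
  exists r z th : R -> R,
    [/\ polar_orbit m%:R a (phi P Q) (psi P Q) z th,
        forall t, 0 < r t, forall t, z t = (r t ^+ m)^-1,
        forall t, x t = r t * cos (th t) & forall t, y t = r t * sin (th t)].
Proof.
move=> m0 hP hQ sol xy0 T0 xyT nst.
pose dx t := a * x t - y t + eval2 P (x t) (y t).
pose dy t := x t + a * y t + eval2 Q (x t) (y t).
have xD (t : R) : is_derive t 1 x (dx t) by have [] := sol t.
have yD (t : R) : is_derive t 1 y (dy t) by have [] := sol t.
have xc : continuous x by move=> t; exact: is_derive1_continuous (xD t).
have yc : continuous y by move=> t; exact: is_derive1_continuous (yD t).
have evc P' : continuous (fun t => eval2 P' (x t) (y t)).
  exact: (eval2_closed (fun f => continuous f) _ _ _ continuous_cstf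
    continuous_addf continuous_mulf).
have dxc : continuous dx.
  apply: (continuous_addf (fun t => a * x t - y t)); last exact: evc.
  apply: (continuous_addf (fun t => a * x t)); last exact: continuous_oppf.
  exact: (continuous_mulf _ _ (continuous_cstf a)).
have dyc : continuous dy.
  apply: (continuous_addf (fun t => x t + a * y t)); last exact: evc.
  apply: (continuous_addf x) => //.
  exact: (continuous_mulf _ _ (continuous_cstf a)).
pose q t := x t * x t + y t * y t.
have q0 t : q t != 0.
  apply/eqP => qt0; apply: (xy0 t); move/eqP: qt0.
  rewrite /q -!expr2 paddr_eq0 ?sqr_ge0// !sqrf_eq0.
  by move=> /andP[/eqP-> /eqP->].
have qVc : continuous (fun t => (q t)^-1).
  move=> t; apply: continuousV => //.
  by apply: (continuous_addf (fun t => x t * x t)); exact: continuous_mulf.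
(* the logarithmic derivative of [r] and the angular speed *)
pose al t := (x t * dx t + y t * dy t) / q t.
pose om t := (x t * dy t + - (y t * dx t)) / q t.
have alc : continuous al.
  apply: (continuous_mulf (fun t => x t * dx t + y t * dy t)) => //.
  by apply: (continuous_addf (fun t => x t * dx t)); exact: continuous_mulf.
have omc : continuous om.
  apply: (continuous_mulf (fun t => x t * dy t + - (y t * dx t))) => //.
  apply: (continuous_addf (fun t => x t * dy t)); first exact: continuous_mulf.
  by apply: continuous_oppf; exact: continuous_mulf.
have [La LaD] := antiderivative al alc.
have [Om OmD] := antiderivative om omc.
have [r0 [t0 [r00 x0E y0E]]] := polar_coordinates _ _ (xy0 0).
pose th t := Om t - (Om 0 - t0).
have thD (t : R) : is_derive t 1 th (om t).
  have := is_derive1B _ _ _ _ _ (OmD t) (is_derive1_cst (Om 0 - t0) t).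
  by move/is_derive1_eq; apply; rewrite subr0.
have th0 : th 0 = t0 by rewrite /th opprB addrC subrK.
have cD (t : R) := is_derive1_compf _ _ _ _ _ (is_derive_cos (th t)) (thD t).
have sD (t : R) := is_derive1_compf _ _ _ _ _ (is_derive_sin (th t)) (thD t).
pose E t := expR (- La t).
have E0 t : 0 < E t by exact: expR_gt0.
have ED (t : R) : is_derive t 1 E (- al t * E t).
  have := is_derive1_compf expR _ t _ _ (is_derive_expR _) (is_derive1N _ _ _ (LaD t)).
  by move/is_derive1_eq; apply; rewrite mulrC.
(* coordinates of the solution in the frame rotated by [th] *)
pose C t := x t * cos (th t) + y t * sin (th t).
pose S t := y t * cos (th t) - x t * sin (th t).
have xalom t : dx t = al t * x t - om t * y t.
  by have := q0 t; rewrite /al /om /q => qn0; field.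
have yalom t : dy t = om t * x t + al t * y t.
  by have := q0 t; rewrite /al /om /q => qn0; field.
(* [C] and [S] solve the same linear equation [u' = al u], so their signs and zeros persist from
   time 0, where [C = r0 > 0] and [S = 0]. *)
have CD (t : R) : is_derive t 1 C (al t * C t).
  have := is_derive1D _ _ _ _ _ (is_derive1M _ _ _ _ _ (xD t) (cD t))
    (is_derive1M _ _ _ _ _ (yD t) (sD t)).
  by move/is_derive1_eq; apply; rewrite xalom yalom /C; ring.
have SD (t : R) : is_derive t 1 S (al t * S t).
  have := is_derive1B _ _ _ _ _ (is_derive1M _ _ _ _ _ (yD t) (cD t))
    (is_derive1M _ _ _ _ _ (xD t) (sD t)).
  by move/is_derive1_eq; apply; rewrite xalom yalom /S; ring.
have cs t : cos (th t) * cos (th t) + sin (th t) * sin (th t) = 1.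
  by rewrite -!expr2 cos2Dsin2.
have Ccst t : C t * E t = C 0 * E 0.
  apply: (derive_eq0_cst (fun t => C t * E t)) => u.
  by have := is_derive1M _ _ _ _ _ (CD u) (ED u); move/is_derive1_eq; apply; ring.
have Scst t : S t * E t = S 0 * E 0.
  apply: (derive_eq0_cst (fun t => S t * E t)) => u.
  by have := is_derive1M _ _ _ _ _ (SD u) (ED u); move/is_derive1_eq; apply; ring.
have C0 t : 0 < C t.
  have : 0 < C t * E t.
    rewrite Ccst mulr_gt0// /C x0E y0E th0 -!mulrA -mulrDr -th0 cs mulr1.
    exact: r00.
  by rewrite pmulr_lgt0.
have S0 t : S t = 0.
  have : S t * E t = 0.
    by rewrite Scst /S x0E y0E th0; ring.
  by move/eqP; rewrite mulf_eq0 [E t == 0]gt_eqF// orbF => /eqP.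
have xC t : x t = C t * cos (th t).
  transitivity (C t * cos (th t) - S t * sin (th t)); last by rewrite S0 mul0r subr0.
  by rewrite -[LHS]mulr1 -(cs t) /C /S; ring.
have yC t : y t = C t * sin (th t).
  transitivity (C t * sin (th t) + S t * cos (th t)); last by rewrite S0 mul0r addr0.
  by rewrite -[LHS]mulr1 -(cs t) /C /S; ring.
have qC t : q t = C t ^+ 2.
  by rewrite /q {1 2}xC {1 2}yC -[RHS]mulr1 -(cs t); ring.
have Cn0 t : C t != 0 by rewrite gt_eqF.
(* Homogeneity extracts [C ^ (m + 1)]; with the factor [C] from [x] or [y] and the division by
   [q = C ^ 2], a factor [C ^ m] remains in the polar equations. *)
have evE P' t : homogeneous m.+1 P' -> eval2 P' (x t) (y t) =
    C t ^+ m.+1 * eval2 P' (cos (th t)) (sin (th t)).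
  by move=> hP'; rewrite xC yC; exact: eval2_homog.
have alE t : al t = a + C t ^+ m * phi P Q (th t).
  have -> : al t = a + (x t * eval2 P (x t) (y t) + y t * eval2 Q (x t) (y t)) / q t.
    by have := q0 t; rewrite /al /dx /dy /q => qn0; field.
  rewrite qC !evE// xC yC /phi exprS.
  by field.
have omE t : om t = 1 + C t ^+ m * psi P Q (th t).
  have -> : om t = 1 + (x t * eval2 Q (x t) (y t) - y t * eval2 P (x t) (y t)) / q t.
    by have := q0 t; rewrite /om /dx /dy /q => qn0; field.
  rewrite qC !evE// xC yC /psi exprS.
  by field.
have Cm0 t : C t ^+ m != 0 by rewrite expf_neq0.
have CT t : C (t + T) = C t.
  apply/eqP; rewrite -(@eqrXn2 _ 2)// ?ltW//.
  by rewrite -!qC /q; have [-> ->] := xyT t.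
have omT t : om (t + T) = om t.
  by rewrite /om /q /dx /dy; have [-> ->] := xyT t.
exists C, (fun t => (C t ^+ m)^-1), th; split=> //.
split.
- by move=> t; rewrite invr_gt0 exprn_gt0.
- move=> t.
  have := is_derive1V (fun s => C s ^+ m) _ _ (Cm0 t) (is_derive1X m _ _ _ (CD t)).
  move/is_derive1_eq; apply; rewrite alE.
  have -> : m%:R * C t ^+ m.-1 * ((a + C t ^+ m * phi P Q (th t)) * C t)
      = m%:R * C t ^+ m * (a + C t ^+ m * phi P Q (th t)).
    by case: (m) m0 => // k _; rewrite /= exprS; ring.
  by field.
- move=> t; apply: (is_derive1_eq _ _ _ _ (thD t)); rewrite omE.
  by field.
(* After time [T] the point and its radius return, hence so do the cosine and sine of the angle, and
   the angle has changed by a multiple of [2 pi]. *)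
- have [k kE] : exists k : int, th T - th 0 = k%:~R * (pi *+ 2).
    apply: cos_eq1; rewrite cosB -[RHS](cs 0).
    have [xT yT] := xyT 0; have CT0 := CT 0; move: xT yT CT0; rewrite add0r.
    rewrite xC yC (xC 0) (yC 0) => + + CT0; rewrite CT0.
    by move=> /(mulfI (Cn0 0))-> /(mulfI (Cn0 0))->.
  exists T, k; split=> // t; split; first by rewrite CT.
  (* [om] is [T]-periodic, so the angle gained over one period is the same from every starting
     time. *)
  have : th (t + T) - th t = th (0 + T) - th 0.
    apply: (derive_eq0_cst (fun t => th (t + T) - th t)) => u.
    have shD := is_derive1D _ _ _ _ _ (is_derive_id u (1 : R)) (is_derive1_cst T u).
    have := is_derive1B _ _ _ _ _ (is_derive1_compf th _ u _ _ (thD (u + T)) shD) (thD u).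
    by move/is_derive1_eq; apply; rewrite omT addr0 mulr1 subrr.
  by rewrite add0r kE => <-; ring.
- have [s [t st]] := nst; exists s, t => -[/invr_inj/eqP].
  rewrite eqrXn2 ?ltW// => /eqP Cst thst; apply: st.
  by rewrite xC yC (xC t) (yC t) Cst thst.
Qed.

(** Both orbits avoid the origin and lift to polar form, where uniqueness applies; exchanging their
    roles then gives equality. *)
Lemma periodic_orbit_sub (m : nat) (a : R) P Q (G1 G2 : set (R * R)) :
  (0 < m)%N -> homogeneous m.+1 P -> homogeneous m.+1 Q ->
  [/\ 0 < a, forall u, psi P Q u < 0 -> 0 <= a * psi P Q u - phi P Q u
    & forall u, 0 < psi P Q u -> 0 <= phi P Q u] \/
  [/\ a < 0, forall u, psi P Q u < 0 -> a * psi P Q u - phi P Q u <= 0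
    & forall u, 0 < psi P Q u -> phi P Q u <= 0] ->
  periodic_orbit a P Q G1 -> ~ G1 (0, 0) ->
  periodic_orbit a P Q G2 -> ~ G2 (0, 0) -> G1 `<=` G2.
Proof.
move=> m0 hP hQ hsign [x1 [y1 [sol1 [T1 T10 xyT1] nst1 ->]]] G10.
move=> [x2 [y2 [sol2 [T2 T20 xyT2] nst2 ->]]] G20.
have xy10 t : (x1 t, y1 t) <> (0, 0) by move=> e; apply: G10; exists t.
have xy20 t : (x2 t, y2 t) <> (0, 0) by move=> e; apply: G20; exists t.
have [r1 [z1 [th1 [pz1 r10 z1E x1E y1E]]]] :=
  polar_lift _ _ _ _ _ _ _ m0 hP hQ sol1 xy10 T10 xyT1 nst1.
have [r2 [z2 [th2 [pz2 r20 z2E x2E y2E]]]] :=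
  polar_lift _ _ _ _ _ _ _ m0 hP hQ sol2 xy20 T20 xyT2 nst2.
have [dpsi cdpsi psiD] := C1_psi P Q.
have mR0 : 0 < m%:R :> R by rewrite ltr0n.
move=> _ [t _ <-].
have [s [zts thts]] := polar_orbit_unique _ _ _ _ _ _ _ _ _ mR0 psiD cdpsi
  (psiD2pi P Q) hsign pz1 pz2 t.
(* [z = r ^- m] with [r > 0] and [m > 0] determines [r]. *)
have rts : r1 t = r2 s.
  move: zts; rewrite z1E z2E => /invr_inj/eqP.
  by rewrite eqrXn2 ?ltW// => /eqP.
by exists s => //; rewrite x1E y1E x2E y2E rts thts.
Qed.

End Planar.

(** * Passage from the angles in [[0, 2 pi]] to all angles, and conclusion *)

Theorem corollary4p3 (R : realType) (n : nat) (a : R) (P Q : bipoly R)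
  (hn : (2 <= n)%N) (hP : homogeneous n P) (hQ : homogeneous n Q)
  (hAB :
    [/\ 0 < a,
        (forall theta : R, theta \in `[0, 2 * pi] ->
           (psi P Q theta < 0 -> 0 <= a * psi P Q theta - phi P Q theta) /\
           (0 < psi P Q theta -> 0 <= phi P Q theta))
      & exists E : set R,
          [/\ E `<=` `[0, 2 * pi], measurable E,
              (0 < lebesgue_measure E)%E
            & forall theta : R, E theta ->
                (psi P Q theta < 0 ->
                   0 < a * psi P Q theta - phi P Q theta) /\
                (0 < psi P Q theta -> 0 < phi P Q theta)]]
    \/
    [/\ a < 0,
        (forall theta : R, theta \in `[0, 2 * pi] ->
           (psi P Q theta < 0 -> a * psi P Q theta - phi P Q theta <= 0) /\
           (0 < psi P Q theta -> phi P Q theta <= 0))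
      & exists E : set R,
          [/\ E `<=` `[0, 2 * pi], measurable E,
              (0 < lebesgue_measure E)%E
            & forall theta : R, E theta ->
                (psi P Q theta < 0 ->
                   a * psi P Q theta - phi P Q theta < 0) /\
                (0 < psi P Q theta -> phi P Q theta < 0)]])
  (G1 G2 : set (R * R)) :
  limit_cycle a P Q G1 -> surrounds_origin G1 ->
  limit_cycle a P Q G2 -> surrounds_origin G2 ->
  G1 = G2.
Proof.
move=> [po1 _] [G10 _] [po2 _] [G20 _].
case: n hn hP hQ => [//|m] m0 hP hQ.
(* The sign conditions are given on [[0, 2 pi]]; the periodicity of [phi] and [psi] extends them to
   every angle reached by a lift. *)
have modulo (u : R) : exists2 v : R, v \in `[0, 2 * pi] &
    phi P Q u = phi P Q v /\ psi P Q u = psi P Q v.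
  have [k [v [/andP[v0 vp] ->]]] := angle_modulo u.
  exists v; first by rewrite in_itv/= v0 mulr_natl ltW.
  by rewrite (periodicMz _ _ (phiD2pi P Q)) (periodicMz _ _ (psiD2pi P Q)).
have hsign :
  [/\ 0 < a, forall u, psi P Q u < 0 -> 0 <= a * psi P Q u - phi P Q u
    & forall u, 0 < psi P Q u -> 0 <= phi P Q u] \/
  [/\ a < 0, forall u, psi P Q u < 0 -> a * psi P Q u - phi P Q u <= 0
    & forall u, 0 < psi P Q u -> phi P Q u <= 0].
  case: hAB => -[a0 h _]; [left|right]; split=> // u.
  - by have [v /h[h1 h2] [-> ->]] := modulo u.
  - by have [v /h[h1 h2] [-> ->]] := modulo u.
  - by have [v /h[h1 h2] [-> ->]] := modulo u.
  - by have [v /h[h1 h2] [-> ->]] := modulo u.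
by apply/seteqP; split; apply: (periodic_orbit_sub m a P Q).
Qed.
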